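(* Let $\mathfrak{B}$ be an algebra over a field $K$. For any multilinear function series $\beta,\gamma\in Mul[[\mathfrak{B}]]$, $${}^cR_{\beta,\gamma}=\left[\beta(1+I\beta)^{-1}\right]\circ(I+I\gamma I)^{\langle -1\rangle}.$$
   Context: Let $\widetilde{\mathfrak{B}}$ be $\mathfrak{B}$ if $\mathfrak{B}$ is unital and the unitization of $\mathfrak{B}$ otherwise. For $n\ge1$, $\mathcal{L}_n(\mathfrak{B})$ is the set of $K$-multilinear maps $\mathfrak{B}^n\to\mathfrak{B}$. A formal multilinear function series over $\mathfrak{B}$ is a sequence $\omega=(\omega_0,\omega_1,\dots)$ with $\omega_0\in\widetilde{\mathfrak{B}}$ and $\omega_n\in\mathcal{L}_n(\mathfrak{B})$ for $n\ge1$; the set of all of them is $Mul[[\mathfrak{B}]]$. Operations: the sum is componentwise; the formal product is $$(\alpha\beta)_n(b_1,\dots,b_n)=\sum_{k=0}^n\alpha_k(b_1,\dots,b_k)\,\beta_{n-k}(b_{k+1},\dots,b_n);$$ if $\beta_0=0$, the formal composition is given by $(\alpha\circ\beta)_0=\alpha_0$ and, for $n\ge1$, $$(\alpha\circ\beta)_n(b_1,\dots,b_n)=\sum_{k=1}^n\ \sum_{\substack{p_1,\dots,p_k\ge1\\ p_1+\dots+p_k=n}}\alpha_k\big(\beta_{p_1}(b_1,\dots,b_{p_1}),\dots,\beta_{p_k}(b_{q_k+1},\dots,b_{q_k+p_k})\big),$$ with $q_j=p_1+\dots+p_{j-1}$. Write $1=(1,0,0,\dots)$ and $I=(0,\mathrm{id}_{\mathfrak{B}},0,0,\dots)$,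 the identities for formal product and formal composition. $\alpha^{-1}$ denotes the inverse with respect to formal product, and $\alpha^{\langle-1\rangle}$ the inverse with respect to formal composition (which exists if and only if $\alpha_0=0$ and $\alpha_1$ is invertible in $\mathcal{L}_1(\mathfrak{B})$). Definition of ${}^cR_{\beta,\gamma}$: for $\beta,\gamma\in Mul[[\mathfrak{B}]]$, ${}^cR_{\beta,\gamma}\in Mul[[\mathfrak{B}]]$ is the series, with components ${}^cR_{\beta,\gamma,k}$, defined by the recurrence (for all $n\ge0$) $$\beta_n(b_1,\dots,b_n)=\sum_{k=0}^n\ \sum_{1=i(0)<i(1)<\dots<i(k)\le n+1}{}^cR_{\beta,\gamma,k}(c_1,\dots,c_k)\; r_{i(k)},$$ where $$c_j=b_{i(j-1)}\,\gamma_{p(j)}\big(b_{i(j-1)+1},\dots,b_{i(j)-2}\big)\,b_{i(j)-1},\qquad p(j)=i(j)-i(j-1)-2,$$ with the convention $c_j=b_{i(j-1)}$ when $p(j)=-1$, and where $r_{i}=b_{i}\,\beta_{n-i}(b_{i+1},\dots,b_n)$ if $i\le n$ and $r_{n+1}=1$. *)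

(* Defs.v *)
From HB Require Import structures.
From mathcomp Require Import all_boot all_algebra.
From mathcomp Require Import boolp classical_sets.

Set Implicit Arguments.
Unset Strict Implicit.
Unset Printing Implicit Defensive.

Import GRing.Theory.
Local Open Scope ring_scope.

(* Associative algebras, not assumed to have a unit (MathComp's algType
   requires a unit distinct from 0). *)
HB.mixin Record isNUAlgebra (K : pzRingType) A of GRing.Lmodule K A := {
  numul : A -> A -> A;
  numulA : associative numul;
  numulDl : left_distributive numul +%R;
  numulDr : right_distributive numul +%R;
  numulZl : forall (k : K) (x y : A), numul (k *: x) y = k *: numul x y;
  numulZr : forall (k : K) (x y : A), numul x (k *: y) = k *: numul x y
}.

#[short(type="nuAlgType")]
HB.structure Definition NUAlgebra (K : pzRingType) :=
  {A of isNUAlgebra K A & GRing.Lmodule K A}.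

Section NUTheory.
Context (K : fieldType) (B : nuAlgType K).
Implicit Types x y : B.

Lemma numul0x y : numul 0 y = 0 :> B.
Proof. by apply: (@addrI _ (numul 0 y)); rewrite -numulDl !addr0. Qed.

Lemma numulx0 x : numul x 0 = 0 :> B.
Proof. by apply: (@addrI _ (numul x 0)); rewrite -numulDr !addr0. Qed.

End NUTheory.

Section Tilde.
Context (K : fieldType) (B : nuAlgType K).

Definition has_unit : Prop :=
  exists e : B, left_id e numul /\ right_id e numul.

Definition unital_alg (h : has_unit) : Type := B.

Section Unital.
Context (h : has_unit).
HB.instance Definition _ := GRing.Lmodule.on (unital_alg h).

Definition unital_one : unital_alg h := projT1 (cid h).
Definition unital_mul (x y : unital_alg h) : unital_alg h :=
  @numul K B x y.

Lemma unital_mulA : associative unital_mul. Proof. exact: numulA. Qed.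
Lemma unital_mul1r : left_id unital_one unital_mul.
Proof. by rewrite /unital_one; case: cid => e []. Qed.
Lemma unital_mulr1 : right_id unital_one unital_mul.
Proof. by rewrite /unital_one; case: cid => e []. Qed.
Lemma unital_mulDl : left_distributive unital_mul +%R.
Proof. exact: numulDl. Qed.
Lemma unital_mulDr : right_distributive unital_mul +%R.
Proof. exact: numulDr. Qed.

HB.instance Definition _ := GRing.Zmodule_isPzRing.Build (unital_alg h)
  unital_mulA unital_mul1r unital_mulr1 unital_mulDl unital_mulDr.
End Unital.

Definition unitization : Type := (K * B)%type.
HB.instance Definition _ := GRing.Lmodule.copy unitization (K^o * B)%type.

Definition unitization_one : unitization := (1, 0).
Definition unitization_mul (x y : unitization) : unitization :=
  (x.1 * y.1, x.1 *: y.2 + y.1 *: x.2 + numul x.2 y.2).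

Lemma unitization_addE (x y : unitization) : x + y = (x.1 + y.1, x.2 + y.2).
Proof. by []. Qed.

Lemma unitization_mulA : associative unitization_mul.
Proof.
move=> [k x] [l y] [m z]; rewrite /unitization_mul /=; congr pair.
  exact: mulrA.
rewrite !numulDl !numulDr !scalerDr !numulZl !numulZr !scalerA numulA.
by rewrite [m * k]mulrC [m * l]mulrC [LHS](AC (4*3) ((1*((2*4)*6))*((3*5)*7))).
Qed.
Lemma unitization_mul1r : left_id unitization_one unitization_mul.
Proof.
by case=> k x; rewrite /unitization_mul /= mul1r scale1r scaler0 numul0x !addr0.
Qed.
Lemma unitization_mulr1 : right_id unitization_one unitization_mul.
Proof.
by case=> k x;
  rewrite /unitization_mul /= mulr1 scale1r scaler0 numulx0 add0r addr0.
Qed.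
Lemma unitization_mulDl : left_distributive unitization_mul +%R.
Proof.
move=> [k x] [l y] [m z]; rewrite unitization_addE /unitization_mul /=.
rewrite unitization_addE /= mulrDl numulDl scalerDl scalerDr.
by rewrite [X in (_, X) = _](AC ((2*2)*2) ((1*3*5)*(2*4*6))).
Qed.
Lemma unitization_mulDr : right_distributive unitization_mul +%R.
Proof.
move=> [m z] [k x] [l y]; rewrite unitization_addE /unitization_mul /=.
rewrite unitization_addE /= mulrDr numulDr scalerDl scalerDr.
by rewrite [X in (_, X) = _](AC ((2*2)*2) ((1*3*5)*(2*4*6))).
Qed.

HB.instance Definition _ := GRing.Zmodule_isPzRing.Build unitization
  unitization_mulA unitization_mul1r unitization_mulr1
  unitization_mulDl unitization_mulDr.

(* B if B has a unit, its unitization otherwise.  Only the ring structure of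
   B~ is used below. *)
Definition tilde_of (d : {has_unit} + {~ has_unit}) : pzRingType :=
  match d with
  | left h => unital_alg h : pzRingType
  | right _ => unitization : pzRingType
  end.
Definition tilde : pzRingType := tilde_of (pselect has_unit).

Definition inclusion_of d : B -> tilde_of d :=
  match d return B -> tilde_of d with
  | left _ => fun b => b
  | right _ => fun b => (0, b)
  end.
Definition inclusion : B -> tilde := @inclusion_of (pselect has_unit).

(* A left inverse of the inclusion, applied below only to elements of the
   ideal B of B~. *)
Definition retract_of d : tilde_of d -> B :=
  match d return tilde_of d -> B with
  | left _ => fun x => x
  | right _ => fun x => x.2
  end.
Definition retract : tilde -> B := @retract_of (pselect has_unit).

Lemma inclusionK : cancel inclusion retract.
Proof. by rewrite /inclusion /retract /tilde; case: pselect. Qed.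

Lemma inclusionD : {morph inclusion : x y / x + y}.
Proof.
rewrite /inclusion /tilde; case: pselect => //= _ x y.
by rewrite unitization_addE /= addr0.
Qed.

Lemma inclusionM : {morph inclusion : x y / numul x y >-> x * y}.
Proof.
rewrite /inclusion /tilde; case: pselect => //= _ x y.
by rewrite [RHS]/GRing.mul /= /unitization_mul /= mulr0 !scale0r !add0r.
Qed.

Lemma inclusion0 : inclusion 0 = 0.
Proof. by apply: (@addrI _ (inclusion 0)); rewrite -inclusionD !addr0. Qed.

Lemma retractD : {morph retract : x y / x + y}.
Proof. by rewrite /retract /tilde; case: pselect. Qed.

Lemma retract0 : retract 0 = 0.
Proof. by rewrite -inclusion0 inclusionK. Qed.

Lemma retract_sum I (r : seq I) (P : pred I) (F : I -> tilde) :
  retract (\sum_(i <- r | P i) F i) = \sum_(i <- r | P i) retract (F i).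
Proof. exact: (big_morph _ retractD retract0). Qed.

Lemma retract_mull_linear (z : tilde) :
  linear (fun x => retract (inclusion x * z)).
Proof.
move: z; rewrite /retract /inclusion /tilde; case: pselect => /= [h|_].
  by move=> z k x y; rewrite [LHS]numulDl numulZl.
move=> [m z] k x y.
rewrite [LHS]/= [X in _ = _ *: X + _]/= [X in _ = _ + X]/=.
rewrite !scale0r !add0r numulDl numulZl !scalerDr !scalerA [m * k]mulrC.
by rewrite [RHS](AC (2*2) ((1*3)*(2*4))).
Qed.

Lemma retract_mulr_linear (z : tilde) :
  linear (fun x => retract (z * inclusion x)).
Proof.
move: z; rewrite /retract /inclusion /tilde; case: pselect => /= [h|_].
  by move=> z k x y; rewrite [LHS]numulDr numulZr.
move=> [m z] k x y.
rewrite [LHS]/= [X in _ = _ *: X + _]/= [X in _ = _ + X]/=.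
rewrite !scale0r !addr0 numulDr numulZr !scalerDr !scalerA [m * k]mulrC.
by rewrite [RHS](AC (2*2) ((1*3)*(2*4))).
Qed.

Definition in_base (x : tilde) : Prop := inclusion (retract x) = x.

Lemma in_base_incl b : in_base (inclusion b).
Proof. by rewrite /in_base inclusionK. Qed.

Lemma in_baseD x y : in_base x -> in_base y -> in_base (x + y).
Proof. by rewrite /in_base retractD inclusionD => -> ->. Qed.

Lemma in_base_sum I (r : seq I) (P : pred I) (F : I -> tilde) :
  (forall i, P i -> in_base (F i)) -> in_base (\sum_(i <- r | P i) F i).
Proof.
move=> F_in; apply: big_ind => //; last exact: in_baseD.
by rewrite -inclusion0; exact: in_base_incl.
Qed.

Lemma in_baseMl x z : in_base x -> in_base (x * z).
Proof.
rewrite /in_base => <-; move: (retract x) => {x} b.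
move: z; rewrite /retract /inclusion /tilde; case: pselect => //= _ [m z].
by rewrite [in RHS]/GRing.mul /= /unitization_mul /= mul0r.
Qed.

Lemma in_baseMr x z : in_base x -> in_base (z * x).
Proof.
rewrite /in_base => <-; move: (retract x) => {x} b.
move: z; rewrite /retract /inclusion /tilde; case: pselect => //= _ [m z].
by rewrite [in RHS]/GRing.mul /= /unitization_mul /= mulr0.
Qed.

End Tilde.

Section Series.
Context (K : fieldType) (B : nuAlgType K).
Local Notation incl := (@inclusion K B).

Definition multilinear n (f : ('I_n -> B) -> B) : Prop :=
  forall (i : 'I_n) (b : 'I_n -> B),
    linear (fun x => f (fun j => if j == i then x else b j)).

Record multimap n := MultiMap {
  mapp :> ('I_n -> B) -> B;
  mappP : multilinear mapp
}.

(* Mul[[B]]: coef0 is the component in B~ and coefS n the one in L_{n+1}(B). *)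
Record mulseries := MulSeries {
  coef0 : tilde B;
  coefS : forall n, multimap n.+1
}.

(* For s = [:: b_1; ...; b_n] with n >= 1, evb a s is a_n(b_1, ..., b_n) in B
   and ev a s is the same element in B~; ev a [::] is a_0. *)
Definition evb (a : mulseries) (s : seq B) : B :=
  if s is x :: s' then coefS a (size s') (fun i => (x :: s')`_i) else 0.

Definition ev (a : mulseries) (s : seq B) : tilde B :=
  if s is [::] then coef0 a else incl (evb a s).

Lemma evE a s : s != [::] -> ev a s = incl (evb a s).
Proof. by case: s. Qed.

Lemma multimapP n (f g : multimap n) : f =1 g -> f = g.
Proof.
case: f g => [f fP] [g gP] /= /funext fg.
by rewrite -{}fg in gP *; rewrite (Prop_irrelevance fP gP).
Qed.

Lemma evb_nth a n (b : 'I_n.+1 -> B) :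
  evb a [seq b i | i <- enum 'I_n.+1] = coefS a n b.
Proof.
have: size [seq b i | i <- enum 'I_n.+1] = n.+1 by rewrite size_map size_enum_ord.
have: forall i : 'I_n.+1, [seq b i | i <- enum 'I_n.+1]`_i = b i.
  by move=> i; rewrite (nth_map i) ?size_enum_ord // nth_ord_enum.
case: [seq b i | i <- enum 'I_n.+1] => // x s + [sn]; rewrite /evb.
by case: n / sn b => b bE; congr (mapp _ _); apply: funext => i; exact: bE.
Qed.

Lemma ev_inj a b : ev a =1 ev b -> a = b.
Proof.
move=> eab; case: a b eab => [a0 a] [b0 b] eab.
have -> : a0 = b0 by exact: (eab [::]).
congr MulSeries; apply: functional_extensionality_dep => n.
apply: multimapP => c; move: (eab [seq c i | i <- enum 'I_n.+1]).
rewrite !evE; last 2 first.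
- by rewrite -size_eq0 size_map size_enum_ord.
- by rewrite -size_eq0 size_map size_enum_ord.
by move/(can_inj (@inclusionK _ B)); rewrite !evb_nth.
Qed.

Lemma seq_update n (b : 'I_n -> B) (i : 'I_n) : exists s1 s2, forall x,
  [seq (if j == i then x else b j) | j <- enum 'I_n] = s1 ++ x :: s2.
Proof.
exists [seq b j | j <- take i (enum 'I_n)], [seq b j | j <- drop i.+1 (enum 'I_n)].
move=> x; have ilt : (i < size (enum 'I_n))%N by rewrite size_enum_ord.
have := cat_take_drop i (enum 'I_n); rewrite (drop_nth i ilt) nth_ord_enum.
move=> eE; have := enum_uniq 'I_n; rewrite -eE cat_uniq /= negb_or.
move=> /and3P[_ /andP[ni1 _] /andP[ni2 _]].
rewrite -[in LHS]eE map_cat /= eqxx; congr (_ ++ _ :: _);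
  apply/eq_in_map => j jin; case: eqP => // ji; move: jin; rewrite ji.
- by rewrite eE (negPf ni1).
- by rewrite eE (negPf ni2).
Qed.

Definition seqlinear (F : seq B -> B) : Prop :=
  forall s1 s2, linear (fun x => F (s1 ++ x :: s2)).

Lemma evb_linear a : seqlinear (evb a).
Proof.
move=> s1 s2 k x y.
pose n := (size s1 + size s2)%N.
have lt1n : (size s1 < n.+1)%N by rewrite ltnS leq_addr.
pose i : 'I_n.+1 := Ordinal lt1n.
pose b (j : 'I_n.+1) : B := (s1 ++ 0 :: s2)`_j.
have sE z : s1 ++ z :: s2 = [seq (if j == i then z else b j) | j <- enum 'I_n.+1].
  apply: (@eq_from_nth _ 0); first by rewrite size_map size_enum_ord size_cat /= addnS.
  move=> m; rewrite size_cat /= addnS => mlt.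
  rewrite (nth_map i) ?size_enum_ord // (nth_ord_enum i (Ordinal mlt)) -val_eqE /=.
  rewrite /b /= !nth_cat; case: (ltngtP m (size s1)) => [//|lt1m|->].
    by rewrite -[(m - size s1)%N](@ltn_predK 0) // subn_gt0.
  by rewrite subnn.
by rewrite !sE !evb_nth; exact: mappP.
Qed.

Lemma series_of_subproof (F : seq B -> B) : seqlinear F ->
  forall n, multilinear (fun b : 'I_n.+1 -> B => F [seq b i | i <- enum 'I_n.+1]).
Proof.
move=> Flin n i b k x y; have [s1 [s2 sE]] := seq_update b i.
by rewrite !sE; exact: Flin.
Qed.

(* The series with components a_0 and
   a_n(b_1, ..., b_n) = F [:: b_1; ...; b_n] for n >= 1. *)
Definition series_of (a0 : tilde B) (F : seq B -> B) (Flin : seqlinear F) :=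
  MulSeries a0 (fun n => MultiMap (series_of_subproof Flin (n := n))).

Lemma ev_series_of a0 F (Flin : seqlinear F) s :
  ev (series_of a0 Flin) s = if s is [::] then a0 else incl (F s).
Proof.
case: s => // x s; rewrite /ev /evb /=; congr (incl (F _)).
apply: (@eq_from_nth _ 0); first by rewrite size_map size_enum_ord.
move=> m; rewrite size_map size_enum_ord => mlt.
by rewrite (nth_map (Ordinal mlt)) ?size_enum_ord // (nth_ord_enum _ (Ordinal mlt)).
Qed.

HB.instance Definition _ := gen_eqMixin mulseries.
HB.instance Definition _ := gen_choiceMixin mulseries.

Lemma seqlinear_sum I (r : seq I) (P : pred I) (F : I -> seq B -> B) :
  (forall i, P i -> seqlinear (F i)) ->
  seqlinear (fun s => \sum_(i <- r | P i) F i s).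
Proof.
move=> Flin s1 s2 k x y; rewrite scaler_sumr -big_split /=.
by apply: eq_bigr => i Pi; exact: Flin.
Qed.

Lemma zero_linear : seqlinear (fun=> 0).
Proof. by move=> s1 s2 k x y; rewrite scaler0 addr0. Qed.
Definition series_zero := series_of 0 zero_linear.

Lemma add_linear a b : seqlinear (fun s => evb a s + evb b s).
Proof.
move=> s1 s2 k x y; rewrite !evb_linear scalerDr.
by rewrite [LHS](AC (2*2) ((1*3)*(2*4))).
Qed.
Definition series_add a b := series_of (coef0 a + coef0 b) (add_linear a b).

Lemma opp_linear a : seqlinear (fun s => - evb a s).
Proof. by move=> s1 s2 k x y; rewrite !evb_linear opprD scalerN. Qed.
Definition series_opp a := series_of (- coef0 a) (opp_linear a).

Lemma ev_zero s : ev series_zero s = 0.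
Proof. by rewrite ev_series_of; case: s => // *; rewrite inclusion0. Qed.

Lemma ev_add a b s : ev (series_add a b) s = ev a s + ev b s.
Proof. by rewrite ev_series_of; case: s => // *; rewrite inclusionD. Qed.

Lemma ev_opp a s : ev (series_opp a) s = - ev a s.
Proof.
apply: (@addrI _ (ev a s)); rewrite addrN ev_series_of.
by case: s => [|x s]; rewrite ?addrN // -inclusionD addrN inclusion0.
Qed.

Lemma series_addA : associative series_add.
Proof. by move=> a b c; apply: ev_inj => s; rewrite !ev_add addrA. Qed.
Lemma series_addC : commutative series_add.
Proof. by move=> a b; apply: ev_inj => s; rewrite !ev_add addrC. Qed.
Lemma series_add0 : left_id series_zero series_add.
Proof. by move=> a; apply: ev_inj => s; rewrite ev_add ev_zero add0r. Qed.
Lemma series_addN : left_inverse series_zero series_opp series_add.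
Proof.
by move=> a; apply: ev_inj => s; rewrite ev_add ev_opp ev_zero addNr.
Qed.

HB.instance Definition _ := GRing.isZmodule.Build mulseries
  series_addA series_addC series_add0 series_addN.

(* The formal product, with values in B~. *)
Definition mul_sum (a b : mulseries) (s : seq B) : tilde B :=
  \sum_(k < (size s).+1) ev a (take k s) * ev b (drop k s).

Lemma mul_linear a b : seqlinear (fun s => retract (mul_sum a b s)).
Proof.
pose F k s := retract (ev a (take k s) * ev b (drop k s)).
move=> s1 s2 k x y; rewrite /mul_sum !size_cat /= !addnS !retract_sum.
pose G s := \sum_(m < (size s1 + size s2).+2) F m s.
suff: seqlinear G by apply.
rewrite /G; move: (_.+2) => N; apply: seqlinear_sum => m _ {k x y G} {}s1 {}s2.
rewrite /F.
have [ms1|s1m] := leqP m (size s1).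
  move=> k x y; rewrite !takel_cat // !drop_cat.
  have E z : ev b (if (m < size s1)%N then drop m s1 ++ z :: s2
                   else drop (m - size s1) (z :: s2)) =
             incl (evb b (drop m s1 ++ z :: s2)).
    rewrite evE; last first.
      by case: ltngtP ms1 => //= [_|->] _; [case: (drop m s1) | rewrite subnn].
    case: ltngtP ms1 => //= -> _.
    by rewrite subnn drop_size.
  by rewrite !E evb_linear retract_mulr_linear.
move=> k x y; rewrite !take_cat !drop_cat ltnNge (ltnW s1m) /=.
have /prednK <- : (0 < m - size s1)%N by rewrite subn_gt0.
rewrite /= !(@evE a); try by case: (s1).
by rewrite evb_linear retract_mull_linear.
Qed.
Definition series_mul a b := series_of (coef0 a * coef0 b) (mul_linear a b).

Lemma ev_mul a b s : ev (series_mul a b) s = mul_sum a b s.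
Proof.
rewrite ev_series_of /mul_sum; case: s => [|x s].
  by rewrite big_ord_recl big_ord0 addr0.
apply: in_base_sum => -[[|k] klt] _ /=.
  by apply: in_baseMr; exact: in_base_incl.
by apply: in_baseMl; exact: in_base_incl.
Qed.

Definition series_one := series_of 1 zero_linear.

Lemma ev_one s : ev series_one s = (s == [::])%:R.
Proof. by rewrite ev_series_of; case: s => //= *; rewrite inclusion0. Qed.

Lemma series_mulA : associative series_mul.
Proof.
move=> a b c; apply: ev_inj => s; rewrite !ev_mul /mul_sum.
transitivity (\sum_(0 <= k < (size s).+1) \sum_(k <= l < (size s).+1)
    ev a (take k s) * ev b (drop k (take l s)) * ev c (drop l s)).
  rewrite -(big_mkord xpredT (fun k => ev a (take k s) *
     ev (series_mul b c) (drop k s))).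
  apply: eq_big_nat => k /andP[_]; rewrite ltnS => ks.
  rewrite ev_mul /mul_sum size_drop mulr_sumr.
  rewrite (_ : index_iota k _ = index_iota (0 + k) (size s).+1) // big_addn.
  rewrite big_mkord subSn //.
  apply: eq_bigr => l _; rewrite mulrA drop_drop take_drop //.
rewrite -(big_mkord xpredT (fun l => ev (series_mul a b) (take l s) * ev c (drop l s))).
pose F k l := ev a (take k s) * ev b (drop k (take l s)) * ev c (drop l s).
transitivity (\sum_(0 <= k < (size s).+1) \sum_(0 <= l < (size s).+1 | (k <= l)%N) F k l).
  by apply: eq_bigr => k _; rewrite (big_nat_widenl _ 0).
rewrite (exchange_big_dep_nat xpredT) //=; apply: eq_big_nat => l /andP[_].
rewrite ltnS => ls; rewrite ev_mul /mul_sum size_takel // mulr_suml.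
rewrite -(big_mkord xpredT (fun k =>
  ev a (take k (take l s)) * ev b (drop k (take l s)) * ev c (drop l s))).
rewrite [RHS](big_nat_widen _ _ (size s).+1) //=.
by apply: eq_big => [k|k kl]; rewrite /F ?ltnS // take_takel.
Qed.

Lemma series_mul1 : left_id series_one series_mul.
Proof.
move=> a; apply: ev_inj => s; rewrite ev_mul /mul_sum big_ord_recl /=.
rewrite take0 drop0 ev_one mul1r big1 ?addr0 // => k _.
by rewrite ev_one; case: s k => [[]|x s k] //=; rewrite mul0r.
Qed.

Lemma series_mulr1 : right_id series_one series_mul.
Proof.
move=> a; apply: ev_inj => s; rewrite ev_mul /mul_sum big_ord_recr /=.
rewrite take_size drop_size ev_one mulr1 big1 ?add0r // => k _.
by rewrite ev_one -size_eq0 size_drop subn_eq0 leqNgt ltn_ord mulr0.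
Qed.

Lemma series_mulDl : left_distributive series_mul series_add.
Proof.
move=> a b c; apply: ev_inj => s; rewrite ev_add !ev_mul /mul_sum -big_split.
by apply: eq_bigr => k _; rewrite ev_add mulrDl.
Qed.

Lemma series_mulDr : right_distributive series_mul series_add.
Proof.
move=> a b c; apply: ev_inj => s; rewrite ev_add !ev_mul /mul_sum -big_split.
by apply: eq_bigr => k _; rewrite ev_add mulrDr.
Qed.

HB.instance Definition _ := GRing.Zmodule_isPzRing.Build mulseries
  series_mulA series_mul1 series_mulr1 series_mulDl series_mulDr.

Lemma id_linear : seqlinear (fun s => if s is [:: x] then x else 0).
Proof.
move=> [|y [|y' s1]] [|z s2] k x x' //=; by rewrite scaler0 addr0.
Qed.
Definition series_id := series_of 0 id_linear.

(* A k-tuple p of positive integers with sum n is a composition of n;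
   reshape p s cuts b_1, ..., b_n into the consecutive blocks of lengths
   p_1, ..., p_k. *)
Definition comp_sum (a b : mulseries) (s : seq B) : B :=
  let n := size s in
  \sum_(1 <= k < n.+1)
    \sum_(p : k.-tuple 'I_n.+1 |
          all (leq 1) (map val p) && (sumn (map val p) == n))
      evb a [seq evb b t | t <- reshape (map val p) s].

Lemma reshape_hole (sh : seq nat) (s1 s2 : seq B) :
    (size s1 < sumn sh)%N ->
  exists T1 t1 t2 T2, forall x,
    reshape sh (s1 ++ x :: s2) = T1 ++ (t1 ++ x :: t2) :: T2.
Proof.
elim: sh s1 => [|m sh IH] s1 //= s1lt.
have [ms1|s1m] := leqP m (size s1).
  have [|T1 [t1 [t2 [T2 E]]]] := IH (drop m s1).
    by rewrite size_drop ltn_subLR.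
  exists (take m s1 :: T1), t1, t2, T2 => x.
  rewrite takel_cat // drop_cat; case: ltngtP ms1 => //= [_|ms] _.
    by rewrite E.
  by move: E; rewrite ms subnn !drop_size => <-.
exists [::], s1, (take (m - size s1).-1 s2), (reshape sh (drop (m - size s1).-1 s2)).
move=> x; rewrite take_cat drop_cat ltnNge (ltnW s1m) /=.
by have /prednK <- : (0 < m - size s1)%N by rewrite subn_gt0.
Qed.

Lemma comp_linear a b : seqlinear (comp_sum a b).
Proof.
move=> s1 s2; rewrite /comp_sum /=.
have E x : size (s1 ++ x :: s2) = (size s1 + size s2).+1.
  by rewrite size_cat /= addnS.
move=> k x y; rewrite !E {E}.
have lt1 : (size s1 < (size s1 + size s2).+1)%N by rewrite ltnS leq_addr.
rewrite scaler_sumr -big_split /=; apply: eq_bigr => m _.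
rewrite scaler_sumr -big_split /=; apply: eq_bigr => p /andP[_ /eqP pN].
have [|T1 [t1 [t2 [T2 E]]]] := @reshape_hole (map val p) s1 s2; first by rewrite pN.
by rewrite !E !map_cat /= !evb_linear.
Qed.

(* Only meaningful when coef0 b = 0. *)
Definition series_comp a b := series_of (coef0 a) (comp_linear a b).

Definition is_mulinv (a b : mulseries) : Prop := a * b = 1 /\ b * a = 1.

Definition is_compinv (a b : mulseries) : Prop :=
  [/\ coef0 a = 0, coef0 b = 0,
      series_comp a b = series_id & series_comp b a = series_id].

(* The inverse is unique when it exists; the value is 0 otherwise. *)
Definition series_mulinv (a : mulseries) : mulseries :=
  xget 0 [set b | is_mulinv a b].
Definition series_compinv (a : mulseries) : mulseries :=
  xget 0 [set b | is_compinv a b].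

(* b_i for s = [:: b_1; ...; b_n] *)
Definition arg (s : seq B) (i : nat) : B := s`_i.-1.

Section CR.
Context (beta gamma : mulseries) (s : seq B).

(* c_j, for l = i(j-1) and m = i(j). *)
Definition cR_arg (l m : nat) : B :=
  if m == l.+1 then arg s l else
  retract (incl (arg s l) * ev gamma (drop l (take (m - 2) s)) * incl (arg s m.-1)).

Definition cR_tail (i : nat) : tilde B :=
  if (i <= size s)%N then incl (arg s i) * ev beta (drop i s) else 1.

Definition cR_sum (R : mulseries) : tilde B :=
  let n := size s in
  \sum_(k < n.+1)
    \sum_(i : k.+1.-tuple 'I_n.+2 |
          (tnth i ord0 == 1%N :> nat) && sorted ltn (map val i))
      ev R [seq cR_arg (nth 0%N (map val i) j.-1) (nth 0%N (map val i) j)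
           | j <- iota 1 k]
      * cR_tail (tnth i ord_max).
End CR.

(* The term k = n of the sum is R_n(b_1, ..., b_n) and the other terms involve
   only R_k with k < n, so this determines R by recursion on n. *)
Definition is_cR (beta gamma R : mulseries) : Prop :=
  forall s : seq B, ev beta s = cR_sum beta gamma s R.

Definition cR (beta gamma : mulseries) : mulseries :=
  xget 0 [set R | is_cR beta gamma R].

End Series.

(* Main.v *)
Require Import Defs.
From mathcomp Require Import all_boot all_algebra.
From mathcomp Require Import boolp classical_sets.

Import GRing.Theory.
Local Open Scope ring_scope.

(** Put eta = I + I gamma I.  In the recurrence defining cR, the argument c_j
    is eta evaluated on the block of variables from i(j-1) to i(j)-1, and the
    factor r_i is the component of 1 + I beta on the variables that are left
    over.  Summing over the indices i(0) < ... < i(k) thus amounts to choosing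
    a prefix of the variables and a composition of its length, so that the
    recurrence reads
<<
      beta = (R o eta) (1 + I beta)
>>
    (lemma [cR_sumE]).  As 1 + I beta is invertible for the product and eta for
    the composition, this equation is equivalent to
    R = (beta (1 + I beta)^-1) o eta^<-1>.

    Three facts make this rigorous.  Formal composition is associative and has
    I as a two-sided unit; associativity rests on a bijection between the ways
    of cutting a sequence into blocks and then cutting the sequence of blocks,
    and the ways of cutting it into large blocks and then cutting each of them
    ([cutsum_cutsum]).  Both inverses exist: an additive operator L on series
    that increases the order of vanishing has all equations b = a + L b
    solvable ([order_raising_fixpoint]), which yields the inverse of 1 + u for
    the product when u_0 = 0 and, because x |-> x - x o b increases the order
    when b = I + higher terms, a left inverse of b for the composition.
    Finally, the sums over tuples of bounded integers in the definitions are
    rewritten as sums over an explicit list of compositions ([big_tuple_seq]),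
    which admits recursion. *)

(** * Cutting a sequence into blocks *)

Section Cuttings.
Context {V : nmodType} {T : Type}.
Implicit Types (s : seq T) (f : seq (seq T) -> V).

(** A cutting c of x :: s' into nonempty consecutive blocks arises from a unique
    cutting of s': either x is a block by itself, or it is prepended to the
    first block.  The sum over all cuttings is set up by this recursion, which
    changes f instead of enumerating lengths, so that identities between such
    sums follow by induction on s with f general. *)
Fixpoint cutsum f s : V :=
  if s is x :: s' then
    cutsum (fun c => f ([:: x] :: c) +
                     (if c is t :: c' then f ((x :: t) :: c') else 0)) s'
  else f [::].

Lemma eq_cutsum {f} g {s} :
  (forall c, flatten c = s -> f c = g c) -> cutsum f s = cutsum g s.
Proof.
elim: s f g => [|x s IH] f g fg /=; first exact: fg.
apply: IH => c cE; rewrite fg /= ?cE //; congr (_ + _).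
by case: c cE => //= t c cE; rewrite fg //= cE.
Qed.

Lemma cutsum0 s : cutsum (fun=> 0 : V) s = 0.
Proof.
elim: s => //= x s IH; rewrite (eq_cutsum (fun=> 0)) // => -[|t c] _;
  by rewrite addr0.
Qed.

Lemma cutsumD f g s :
  cutsum (fun c => f c + g c) s = cutsum f s + cutsum g s.
Proof.
elim: s f g => [//|x s IH] f g /=; rewrite -IH; apply: eq_cutsum => c _.
by case: c => [|t c]; rewrite ?addr0 // addrACA.
Qed.

(** A cutting with as many blocks as letters has only blocks of length 1. *)
Lemma cutsum_singletons f s :
    (forall c, flatten c = s -> (size c < size s)%N -> f c = 0) ->
  cutsum f s = f [seq [:: x] | x <- s].
Proof.
elim: s f => [//|x s IH] f f0 /=; rewrite IH => [|c cE sc].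
  case: s f0 {IH} => [|y s] f0 /=; first by rewrite addr0.
  rewrite [X in _ + X]f0 ?addr0 //= ?size_map //.
  by congr [:: _, _ & _]; elim: s {f0} => //= z s ->.
rewrite f0 /= ?cE // add0r; case: c cE sc => // t c /= cE sc.
by rewrite f0 /= ?cE //; exact: leqW.
Qed.

End Cuttings.

Lemma cutsum_morph {V W : nmodType} {T : Type} (phi : V -> W) f (s : seq T) :
    phi 0 = 0 -> {morph phi : x y / x + y} ->
  phi (cutsum f s) = cutsum (fun c => phi (f c)) s.
Proof.
move=> phi0 phiD; elim: s f => [//|x s IH] f /=; rewrite IH.
by apply: eq_cutsum => -[|t c] _; rewrite phiD ?phi0.
Qed.

Lemma cutsum_map {V : nmodType} {S T : Type} (g : S -> T)
    (f : seq (seq T) -> V) s :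
  cutsum f (map g s) = cutsum (fun c => f (map (map g) c)) s.
Proof.
by elim: s f => [//|x s IH] f /=; rewrite IH; apply: eq_cutsum => -[|t c].
Qed.

Fixpoint cutsum_each {V : nmodType} {T : Type} (f : seq (seq (seq T)) -> V)
    (w : seq (seq T)) : V :=
  if w is t :: w' then cutsum (fun c => cutsum_each (fun u => f (c :: u)) w') t
  else f [::].

Lemma eq_cutsum_each {V : nmodType} {T : Type}
    (f g : seq (seq (seq T)) -> V) w :
  f =1 g -> cutsum_each f w = cutsum_each g w.
Proof. by move/funext->. Qed.

Lemma cutsum_eachD {V : nmodType} {T : Type} (f g : seq (seq (seq T)) -> V) w :
  cutsum_each (fun u => f u + g u) w = cutsum_each f w + cutsum_each g w.
Proof.
elim: w f g => [//|t w IH] f g /=; rewrite -cutsumD.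
by apply: eq_cutsum => c _; rewrite IH.
Qed.

(** The combinatorial core of the associativity of composition: grouping the
    blocks of a cutting and refining the blocks of a coarser one describe the
    same two-level cuttings.  Prepending a letter x to s gives the same three
    cases from either point of view: x is a small block and a large one (f1),
    x is a small block at the head of a longer large block (f2), or x joins the
    first small block (f3). *)
Lemma cutsum_cutsum {V : nmodType} {T : Type} (f : seq (seq (seq T)) -> V) s :
  cutsum (cutsum f) s = cutsum (cutsum_each f) s.
Proof.
elim: s f => [//|x s IH] f /=.
pose f1 u := f ([:: [:: x]] :: u).
pose f2 u := if u is v :: u' then f (([:: x] :: v) :: u') else 0.
pose f3 u := if u is (t :: v) :: u' then f (((x :: t) :: v) :: u') else 0.
transitivity (cutsum (cutsum (fun u => f1 u + f2 u + f3 u)) s).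
  apply: eq_cutsum => c _; rewrite [RHS]cutsumD; congr (_ + _).
  by case: c => [//|t c] /=; apply: eq_cutsum => -[|u c'] _ //=; rewrite add0r.
rewrite IH; apply: eq_cutsum => w _.
transitivity (cutsum_each f1 w + cutsum_each (fun u => f2 u + f3 u) w).
  by rewrite -cutsum_eachD; apply: eq_cutsum_each => u; rewrite addrA.
congr (_ + _); first by rewrite /= addr0.
case: w => [|t w] /=; first by rewrite addr0.
apply: eq_cutsum => c _; rewrite cutsum_eachD; congr (_ + _).
case: c => [|d c] //=; elim: w => //= t' w w0.
by rewrite (eq_cutsum (fun=> 0)) ?cutsum0.
Qed.

(** * Compositions of an integer *)

(** The recursion mirrors that of [cutsum]: the summands are the lengths of the
    blocks. *)
Fixpoint compositions (n : nat) : seq (seq nat) :=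
  if n is m.+1 then
    [seq 1%N :: c | c <- compositions m] ++
    [seq (head 0%N c).+1 :: behead c | c <- compositions m & c != [::]]
  else [:: [::]].

Lemma mem_compositions n c :
  (c \in compositions n) = all (leq 1) c && (sumn c == n).
Proof.
elim: n c => [|n IH] c.
  by case: c => [|[|p] c]; rewrite ?inE //= andbF.
rewrite mem_cat; case: c => [|p c] /=.
  by apply/negbTE/norP; split; apply/negP => /mapP[].
case: p => [|[|p]] /=.
- by apply/negbTE/norP; split; apply/negP => /mapP[].
- rewrite mem_map => [|? ? []//]; rewrite IH add1n eqSS orbC.
  case: mapP => // -[[|p c']]; rewrite mem_filter ?IH //= => c'P [p0 _].
  by rewrite -p0 in c'P.
- rewrite addSn eqSS; apply/orP/idP => [[/mapP[]//|/mapP[[|q d]]]|pc].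
    by rewrite mem_filter.
  + by rewrite mem_filter IH /= => /andP[/andP[_ dP] dS] [-> ->]; apply/andP.
  right; apply/mapP; exists (p.+1 :: c) => //.
  by rewrite mem_filter IH.
Qed.

Lemma compositions_uniq n : uniq (compositions n).
Proof.
elim: n => //= n IH; rewrite cat_uniq map_inj_uniq ?IH => [/=|? ? []//].
apply/andP; split.
  apply/hasPn => c' /mapP[[|p c]]; rewrite mem_filter //= mem_compositions.
  move=> cP ->.
  by apply/mapP => -[d _ [p0 _]]; rewrite p0 in cP.
rewrite map_inj_in_uniq ?filter_uniq // => -[|p c] [|q d];
  by rewrite !mem_filter //= => _ _ [-> ->].
Qed.

Lemma cutsum_compositions {V : nmodType} {T : Type} (f : seq (seq T) -> V) s :
  cutsum f s = \sum_(c <- compositions (size s)) f (reshape c s).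
Proof.
elim: s f => [|x s IH] f /=; first by rewrite big_seq1.
rewrite IH big_split big_cat !big_map big_filter /=; congr (_ + _).
  by apply: eq_bigr => c _; rewrite /= take0 drop0.
by rewrite [RHS]big_mkcond; apply: eq_bigr => -[|p c].
Qed.

(** The index type on the left depends on the length and on the bound of the
    entries, both of which change in a recursion; the list r need not. *)
Lemma big_tuple_seq {V : nmodType} (N : nat) (K : seq nat) (r : seq (seq nat))
    (P : pred (seq nat)) (F : seq nat -> V) :
    uniq K -> uniq r ->
    (forall c, (c \in r) = [&& size c \in K, all (ltn^~ N.+1) c & P c]) ->
  \sum_(k <- K) \sum_(p : k.-tuple 'I_N.+1 | P (map val p)) F (map val p) =
  \sum_(c <- r) F c.
Proof.
move=> uK ur rE.
transitivity (\sum_(k <- K) \sum_(c <- r | size c == k) F c); last first.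
  rewrite (exchange_big_dep xpredT) //= big_seq [RHS]big_seq.
  apply: eq_bigr => c; rewrite rE => /and3P[cK _ _].
  under eq_bigl do rewrite eq_sym.
  by rewrite -big_filter filter_pred1_uniq // big_seq1.
rewrite big_seq [RHS]big_seq; apply: eq_bigr => k kK.
pose cut (p : k.-tuple 'I_N.+1) := map val p.
transitivity (\sum_(c <- map cut (filter (P \o cut) (index_enum _))) F c).
  by rewrite big_map big_filter.
rewrite -[RHS]big_filter.
apply: perm_big; apply: uniq_perm.
- rewrite map_inj_uniq ?filter_uniq ?index_enum_uniq // => p q.
  by move/(inj_map val_inj)/val_inj.
- exact: filter_uniq.
move=> c; rewrite mem_filter rE; apply/mapP/and4P => [[p]|[/eqP sc _ cN Pc]].
  rewrite mem_filter => /andP[Pp _ ->]; rewrite size_map size_tuple.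
  by split=> //; apply/allP => _ /mapP[i _ ->]; exact: ltn_ord.
have cE : map val (map (@inord N) c) = c.
  rewrite -map_comp -[RHS]map_id; apply/eq_in_map => i ic /=.
  by rewrite inordK //; exact: (allP cN).
have sc' : size (map (@inord N) c) == k by rewrite size_map sc.
exists (Tuple sc'); last by rewrite /cut cE.
by rewrite mem_filter mem_index_enum /cut /= cE Pc.
Qed.

Lemma size_le_sumn c : all (leq 1) c -> (size c <= sumn c)%N.
Proof.
by elim: c => //= p c IH /andP[p1 /IH]; rewrite -add1n; exact: leq_add.
Qed.

(** The indices i(0) < ... < i(k) and the block lengths i(j) - i(j-1) determine
    each other through [scanl addn] and its inverse, the list of successive
    differences. *)
Lemma path_scanl_addn x c : path ltn x (scanl addn x c) = all (leq 1) c.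
Proof. by elim: c x => //= p c IH x; rewrite IH -{1}[x]addn0 ltn_add2l. Qed.

Lemma last_scanl_addn x c : last x (scanl addn x c) = (x + sumn c)%N.
Proof. by elim: c x => [|p c IH] x /=; rewrite ?addn0 // IH addnA. Qed.

Lemma scanl_addn_diff x p :
  path ltn x p -> scanl addn x (pairmap (fun y z => z - y)%N x p) = p.
Proof.
by elim: p x => //= y p IH x /andP[/ltnW xy yp]; rewrite subnKC // IH.
Qed.

Lemma path_ltn_le_last x p : path ltn x p -> all (leq^~ (last x p)) (x :: p).
Proof.
elim: p x => /= [|y p IH] x; first by rewrite leqnn.
move=> /andP[xy /IH /= /andP[yl ->]]; rewrite yl.
by rewrite (leq_trans (ltnW xy) yl).
Qed.

(** * Formal composition *)

Definition slot_additive {U V : zmodType} (F : seq U -> V) : Prop :=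
  forall s1 s2 x y,
    F (s1 ++ (x + y) :: s2) = F (s1 ++ x :: s2) + F (s1 ++ y :: s2).

Lemma slot_additive0 {U V : zmodType} (F : seq U -> V) s1 s2 :
  slot_additive F -> F (s1 ++ 0 :: s2) = 0.
Proof.
by move=> FD; apply: (@addrI _ (F (s1 ++ 0 :: s2))); rewrite -FD !addr0.
Qed.

(** This is where multilinearity enters the associativity of composition. *)
Lemma slot_additive_cutsum {U V : zmodType} {T : Type} (F : seq U -> V)
    (h : seq (seq T) -> U) w :
    slot_additive F ->
  F (map (cutsum h) w) = cutsum_each (fun u => F (map h u)) w.
Proof.
elim: w F => [//|t w IH] F FD /=.
rewrite (cutsum_morph (fun x => F (x :: map (cutsum h) w))).
- apply: eq_cutsum => c _; rewrite (IH (fun u => F (h c :: u))) // => s1 s2.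
  exact: (FD (h c :: s1)).
- exact: (slot_additive0 F [::]).
- exact: (FD [::]).
Qed.

Section Series.
Context {K : fieldType} {B : nuAlgType K}.
Local Notation series := (mulseries B).
Local Notation I := (series_id B).
Local Notation incl := (@inclusion K B).
Implicit Types (a b : series) (s : seq B).

Lemma ev_slot_additive a : slot_additive (ev a).
Proof.
move=> s1 s2 x y; rewrite !evE; try by case: (s1).
by rewrite -inclusionD -[x in LHS]scale1r evb_linear scale1r.
Qed.

Lemma comp_sumE a b s :
  comp_sum a b s = cutsum (fun t => evb a (map (evb b) t)) s.
Proof.
case: s => [|x s]; first by rewrite /comp_sum big_geq.
rewrite cutsum_compositions /comp_sum; set n := size (x :: s).
apply: (big_tuple_seq _ _ (compositions n)
         (fun p => all (leq 1) p && (sumn p == n))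
         (fun p => evb a [seq evb b t | t <- reshape p (x :: s)])).
- exact: iota_uniq.
- exact: compositions_uniq.
move=> p; rewrite mem_compositions.
case: (boolP (all (leq 1) p)) => [p1|_]; last by rewrite !andbF.
case: eqP => [pn|_]; last by rewrite !andbF.
rewrite !andbT; apply/esym/andP; split.
  rewrite mem_index_iota ltnS -pn size_le_sumn // andbT.
  by case: p pn {p1}.
apply/allP => q qp; rewrite /= ltnS -pn.
by have /perm_sumn -> := perm_to_rem qp; exact: leq_addr.
Qed.

Lemma ev_comp a b s :
  ev (series_comp a b) s = cutsum (fun t => ev a (map (evb b) t)) s.
Proof.
rewrite ev_series_of; case: s => // x s.
rewrite comp_sumE (cutsum_morph _ _ _ (@inclusion0 K B) (@inclusionD K B)).
by apply: eq_cutsum => -[].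
Qed.

Lemma evb_comp a b s :
  evb (series_comp a b) s = cutsum (fun t => evb a (map (evb b) t)) s.
Proof.
case: s => // x s; apply: (can_inj (@inclusionK K B)).
by rewrite -comp_sumE -evE // ev_series_of.
Qed.

Lemma comp_seriesA a b c :
  series_comp (series_comp a b) c = series_comp a (series_comp b c).
Proof.
apply: ev_inj => s; rewrite !ev_comp.
pose h u := evb b (map (evb c) u).
transitivity (cutsum (cutsum (fun u => ev a (map h u))) s).
  apply: eq_cutsum => t _; rewrite ev_comp cutsum_map.
  by apply: eq_cutsum => u _; rewrite -map_comp.
rewrite cutsum_cutsum; apply: eq_cutsum => t _.
rewrite -slot_additive_cutsum; last exact: ev_slot_additive.
by congr (ev a _); apply: eq_map => u; rewrite evb_comp.
Qed.

Lemma evb_id s : evb I s = if s is [:: x] then x else 0.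
Proof.
case: s => // x s; apply: (can_inj (@inclusionK K B)).
by rewrite -evE // ev_series_of.
Qed.

Lemma ev_comp_singletons a b s :
    (forall x, evb b [:: x] = x) ->
    (forall t, flatten t = s -> (size t < size s)%N ->
       ev a (map (evb b) t) = 0) ->
  ev (series_comp a b) s = ev a s.
Proof.
move=> b1 a0; rewrite ev_comp cutsum_singletons // -map_comp.
by rewrite (eq_map (g := id)) ?map_id.
Qed.

(** The identity series kills every block of length other than 1, so that only
    the cutting into single letters contributes. *)
Lemma comp_series_id a : series_comp a I = a.
Proof.
apply: ev_inj => s; apply: ev_comp_singletons => [x|t ts st].
  by rewrite evb_id.
have [u ut u1] : exists2 u, u \in t & size u != 1%N.
  apply/hasP; apply: contraLR st => /hasPn t1; rewrite -leqNgt -ts.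
  elim: t t1 {ts} => //= u t IH t1; rewrite size_cat.
  have /eqP -> : size u == 1%N by apply/negPn/t1; rewrite mem_head.
  by apply: IH => v vt; apply: t1; rewrite inE vt orbT.
case/splitPr: ut => t1 t2; rewrite map_cat /= evb_id.
by case: u u1 => [|x [|y u]] //= _;
  exact: (slot_additive0 _ _ _ (ev_slot_additive a)).
Qed.

Lemma cutsum_one_block (g : seq B -> tilde B) s :
  cutsum (fun t => if t is [:: u] then g u else 0) s =
  if s is [::] then 0 else g s.
Proof.
case: s => // x s; elim: s x g => [|y s IH] x g; first by rewrite /= addr0.
rewrite -(IH y (fun u => g (x :: u))) /=.
by apply: eq_cutsum => -[|u [|v t]] _; rewrite !add0r.
Qed.

Lemma id_comp_series b : ev b [::] = 0 -> series_comp I b = b.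
Proof.
move=> b0; apply: ev_inj => s; rewrite ev_comp.
transitivity
  (cutsum (fun t => if t is [:: u] then incl (evb b u) else 0) s).
  by apply: eq_cutsum => -[|u [|v t]] _; rewrite ev_series_of //= inclusion0.
by rewrite cutsum_one_block; case: s.
Qed.

(** * Inverses *)

Definition vanish_below n a := forall s, (size s < n)%N -> ev a s = 0.

(** The solution is the geometric series a + L a + L (L a) + ...; its value on
    s is a finite sum, since L^k a vanishes on sequences of length less than k.
    On sequences of length at most n it agrees with the n-th partial sum S n,
    for which the identity a + L (S n) = S n + L^(n+1) a telescopes. *)
Lemma order_raising_fixpoint (L : series -> series) :
    {morph L : a b / a + b} ->
    (forall n a, vanish_below n a -> vanish_below n.+1 (L a)) ->
  forall a, exists b, b = a + L b.
Proof.
move=> LD Lv a.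
have Fl : seqlinear (fun s => \sum_(k < (size s).+1) evb (iter k L a) s).
  move=> s1 s2; set n := (size s1 + (size s2).+1).+1.
  have : seqlinear (fun s => \sum_(k < n) evb (iter k L a) s).
    by apply: seqlinear_sum => k _; exact: evb_linear.
  by move/(_ s1 s2); rewrite /n => H k x y; move: (H k x y); rewrite !size_cat.
pose b := series_of (ev a [::]) Fl.
pose S n := \sum_(k < n.+1) iter k L a.
have iter0 k : vanish_below k (iter k L a) by elim: k => [//|k IH]; exact: Lv.
have evS n s : ev (S n) s = \sum_(k < n.+1) ev (iter k L a) s.
  have D : {morph (fun x : series => ev x s) : x y / x + y}.
    by move=> x y; exact: ev_add.
  have Z : ev (0 : series) s = 0 by exact: ev_zero.
  exact: (big_morph _ D Z).
have evb_ s : ev b s = ev (S (size s)) s.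
  rewrite evS ev_series_of; case: s => [|x s]; first by rewrite big_ord1.
  exact: (big_morph _ (@inclusionD K B) (@inclusion0 K B)).
have bS n : vanish_below n.+1 (b - S n).
  move=> s; rewrite ltnS => sn; rewrite ev_add ev_opp evb_ !evS.
  apply/eqP; rewrite subr_eq0; apply/eqP.
  rewrite -!(big_mkord xpredT (fun k => ev (iter k L a) s)).
  rewrite [RHS](@big_cat_nat _ _ _ (size s).+1) //=.
  rewrite [X in _ = _ + X]big_nat [X in _ = _ + X]big1 ?addr0 //.
  move=> k /andP[sk _]; exact: iter0.
have LS n : a + L (S n) = S n + iter n.+1 L a.
  elim: n => [|n IH]; first by rewrite /S big_ord1.
  have SS : S n.+1 = S n + iter n.+1 L a by rewrite /S big_ord_recr.
  by rewrite SS LD addrA IH.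
exists b; apply: ev_inj => s; pose n := size s.
(* Only the values up to length n matter, so b may be replaced by S n. *)
rewrite -{2}(subrK (S n) b) LD addrCA LS !ev_add (Lv _ _ (bS n)) // add0r.
by rewrite evb_ iter0 ?addr0.
Qed.

(** Multiplication by u on either side raises the order, as u_0 = 0; the fixed
    points of x |-> 1 - u x and x |-> 1 - x u are a right and a left inverse of
    1 + u, hence equal. *)
Lemma mulinv_exists (u : series) :
  ev u [::] = 0 -> exists v, is_mulinv (1 + u) v.
Proof.
move=> u0.
have [||v vE] := order_raising_fixpoint (fun x => - (u * x)) _ _ 1.
- by move=> x y; rewrite mulrDr opprD.
- move=> n x xn s sn; rewrite ev_opp ev_mul /mul_sum big1 ?oppr0 //.
  move=> -[k ks] _ /=.
  have [->|s0] := eqVneq (take k s) [::]; first by rewrite u0 mul0r.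
  rewrite xn ?mulr0 // size_drop.
  move: s0 sn ks; case: k s => [|k] [|x0 s] //= _ sn ks.
  by rewrite subSS (leq_ltn_trans (leq_subr _ _)).
have [||w wE] := order_raising_fixpoint (fun x => - (x * u)) _ _ 1.
- by move=> x y; rewrite mulrDl opprD.
- move=> n x xn s sn; rewrite ev_opp ev_mul /mul_sum big1 ?oppr0 //.
  move=> -[k ks] _ /=.
  have [->|s0] := eqVneq (drop k s) [::]; first by rewrite u0 mulr0.
  rewrite -size_eq0 size_drop subn_eq0 -ltnNge in s0.
  by rewrite xn ?mul0r // size_takel ?(leq_trans s0) // ltnW.
have uv : (1 + u) * v = 1 by rewrite mulrDl mul1r {1}vE subrK.
have wu : w * (1 + u) = 1 by rewrite mulrDr mulr1 {1}wE subrK.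
have vw : v = w by rewrite -[v]mul1r -wu -mulrA uv mulr1.
by exists v; split; rewrite // vw.
Qed.

(** If b has linear part the identity, then a and a o b have the same value on a
    sequence s whenever a vanishes on shorter sequences: only the cutting of s
    into single letters matters.  Hence x |-> x - x o b raises the order. *)
Lemma comp_left_solve b :
  (forall x, evb b [:: x] = x) -> forall a, exists c, series_comp c b = a.
Proof.
move=> b1 a.
have [||c cE] := order_raising_fixpoint (fun x => x - series_comp x b) _ _ a.
- move=> x y; apply: ev_inj => s; rewrite !(ev_add, ev_opp) !ev_comp.
  rewrite (eq_cutsum (fun t => ev x (map (evb b) t) + ev y (map (evb b) t))).
    by rewrite cutsumD opprD addrACA.
  by move=> t _; rewrite ev_add.
- move=> n x xn s sn; rewrite ev_add ev_opp ev_comp_singletons ?addrN //.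
  by move=> t _ ts; rewrite xn // size_map (leq_trans ts).
exists c; apply: (@addrI _ c).
by rewrite {1}cE -addrA subrK addrC.
Qed.

(** Left inverses suffice: a left inverse c of b has the same shape as b, so it
    has a left inverse d in turn, and associativity forces d = b. *)
Lemma compinv_exists b : ev b [::] = 0 -> (forall x, evb b [:: x] = x) ->
  exists c, is_compinv b c.
Proof.
move=> b0 b1; have [c cb] := comp_left_solve b b1 I.
have c0 : ev c [::] = 0.
  by have := ev_comp c b [::]; rewrite cb /= => <-.
have c1 x : evb c [:: x] = x.
  apply: (can_inj (@inclusionK K B)).
  rewrite -evE // -(ev_comp_singletons c b) ?cb ?evE ?evb_id //.
  by case.
have [d dc] := comp_left_solve c c1 I.
have db : d = b.
  by rewrite -[LHS]comp_series_id -cb -comp_seriesA dc id_comp_series.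
by exists c; split; rewrite // -db.
Qed.

(** * The recurrence as an identity of series *)

Lemma ev_id s : ev I s = if s is [:: x] then incl x else 0.
Proof.
case: s => [//|x s]; rewrite evE // evb_id.
by case: s => // *; rewrite inclusion0.
Qed.

Lemma ev_id_mul a s :
  ev (I * a) s = if s is x :: s' then incl x * ev a s' else 0.
Proof.
rewrite ev_mul /mul_sum big_ord_recl take0 ev_id mul0r add0r.
case: s => [|x s]; first by rewrite big_ord0.
rewrite big_ord_recl [take _ _]/= [drop _ _]/= take0 drop0 ev_id.
rewrite big1 ?addr0 // => k _; rewrite ev_id.
by case: s k => [[]|y s k] //=; rewrite mul0r.
Qed.

Lemma ev_mul_id_nil a : ev (a * I) [::] = 0.
Proof. by rewrite ev_mul /mul_sum big_ord_recl big_ord0 ev_id mulr0 addr0. Qed.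

Lemma ev_mul_id_rcons a s x : ev (a * I) (rcons s x) = ev a s * incl x.
Proof.
rewrite ev_mul /mul_sum size_rcons !big_ord_recr /= -cats1.
rewrite take_size_cat // drop_size_cat // ev_id.
rewrite drop_oversize ?size_cat ?addn1 // ev_id mulr0 addr0.
rewrite big1 ?add0r // => k _; rewrite drop_cat ltn_ord ev_id.
have := size_drop k s; have := ltn_ord k; rewrite -subn_gt0.
case: (drop k s) => [|y [|z u]] /=; rewrite ?mulr0 // => kp ks.
  by rewrite -ks in kp.
Qed.

Section Eta.
Context (g : series).
Definition cR_eta := I + I * g * I.

Lemma cR_eta_nil : ev cR_eta [::] = 0.
Proof. by rewrite ev_add ev_id ev_mul_id_nil addr0. Qed.

Lemma cR_eta_singleton x : evb cR_eta [:: x] = x.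
Proof.
apply: (can_inj (@inclusionK K B)); rewrite -evE // ev_add ev_id.
by rewrite -[X in ev _ X]/(rcons [::] x) ev_mul_id_rcons ev_id_mul mul0r addr0.
Qed.

Lemma cR_eta_ends x s y :
  evb cR_eta (x :: rcons s y) = retract (incl x * ev g s * incl y).
Proof.
rewrite -[LHS](@inclusionK K B) -evE // ev_add ev_id.
rewrite -[X in ev (_ * _) X]/(rcons (x :: s) y) ev_mul_id_rcons ev_id_mul.
by case: s => *; rewrite add0r.
Qed.

(** The two cases in the definition of c_j are the two summands of
    eta = I + I gamma I: I is supported on blocks of length 1, and I gamma I on
    blocks of length at least 2, where it splits off both ends. *)
Lemma cR_argE s l p : (0 < l)%N -> (0 < p)%N -> (l.-1 + p <= size s)%N ->
  cR_arg g s l (l + p) = evb cR_eta (take p (drop l.-1 s)).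
Proof.
case: l p => // l [//|p] _ _; rewrite /= addnS => ls.
have lts : (l < size s)%N by rewrite (leq_trans _ ls) // ltnS leq_addr.
rewrite (drop_nth 0 lts) [take _ _]/= /cR_arg /arg -[l.+1.-1]/l.
case: p ls => [|p] ls; first by rewrite addn1 eqxx take0 cR_eta_singleton.
rewrite ifN; last by rewrite -[l.+2]addn1 eqn_add2l.
rewrite (take_nth 0); last by rewrite size_drop ltn_subRL addSn -addnS.
by rewrite cR_eta_ends nth_drop !addnS subn2 take_drop addnC.
Qed.

Lemma map_cR_arg s l c : (0 < l)%N -> all (leq 1) c ->
    (l.-1 + sumn c <= size s)%N ->
  pairmap (cR_arg g s) l (scanl addn l c) =
  map (evb cR_eta) (reshape c (drop l.-1 s)).
Proof.
elim: c l => //= p c IH l l0 /andP[p0 c1]; rewrite addnA => ls.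
rewrite cR_argE //; last exact: leq_trans (leq_addr _ _) ls.
have lp : (l + p).-1 = (l.-1 + p)%N by case: (l) l0.
by rewrite IH ?addn_gt0 ?l0 ?lp // drop_drop addnC.
Qed.
End Eta.

Lemma map_nth_pairmap {S} (f : nat -> nat -> S) x p :
  [seq f (nth 0%N (x :: p) j.-1) (nth 0%N (x :: p) j) | j <- iota 1 (size p)] =
  pairmap f x p.
Proof.
elim: p x => //= y p IH x; congr (_ :: _).
by rewrite -IH -[2%N]/(1 + 1)%N iotaDl -map_comp; apply/eq_in_map => -[|j] //;
  rewrite mem_iota.
Qed.

Lemma reshape_take {S} c (s : seq S) :
  reshape c (take (sumn c) s) = reshape c s.
Proof.
elim: c s => //= p c IH s; congr (_ :: _).
  by rewrite take_takel // leq_addr.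
by rewrite -(IH (drop p s)) take_drop addnC.
Qed.

(** The convention r_{n+1} = 1 is the component 1 of 1 + I beta. *)
Lemma cR_tailE b s m : (m <= size s)%N ->
  cR_tail b s m.+1 = ev (1 + I * b) (drop m s).
Proof.
move=> ms; rewrite ev_add ev_one ev_id_mul /cR_tail /arg /=.
case: ltnP => [ms'|sm]; first by rewrite (drop_nth 0 ms') add0r.
by rewrite drop_oversize // addr0.
Qed.

(** A strictly increasing sequence i(0) = 1 < ... < i(k) <= n + 1 is the
    sequence of partial sums of a composition of m = i(k) - 1 <= n, where m is
    the length of the prefix on which R o eta is evaluated. *)
Lemma cR_sumE b g s R :
  cR_sum b g s R = ev (series_comp R (cR_eta g) * (1 + I * b)) s.
Proof.
rewrite ev_mul /mul_sum /cR_sum; set n := size s.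
pose P i := (head 0%N i == 1%N) && sorted ltn i.
pose F i := ev R [seq cR_arg g s (nth 0%N i j.-1) (nth 0%N i j)
                 | j <- iota 1 (size i).-1] * cR_tail b s (last 0%N i).
pose r := [seq 1%N :: scanl addn 1%N c | m <- iota 0 n.+1, c <- compositions m].
(* The tuple i has k + 1 entries, hence the shift of the range of lengths. *)
transitivity (\sum_(k <- index_iota 1 n.+2)
  \sum_(i : k.-tuple 'I_n.+2 | P (map val i)) F (map val i)).
  rewrite big_add1 big_mkord; apply: eq_bigr => k _.
  apply: eq_big => i; first by case/tupleP: i => x i; rewrite tnth0.
  move=> _; rewrite /F size_map size_tuple; congr (_ * cR_tail _ _ _).
  case/tupleP: i => x i.
  by rewrite (tnth_nth x) /= last_map (last_nth x) size_tuple.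
rewrite (@big_tuple_seq _ _ _ r).
- rewrite big_allpairs_dep -[iota 0 n.+1]/(index_iota 0 n.+1) big_mkord.
  apply: eq_bigr => -[m mn] _ /=; rewrite ltnS in mn.
  rewrite ev_comp cutsum_compositions mulr_suml size_takel //.
  rewrite big_seq [RHS]big_seq.
  apply: eq_bigr => c; rewrite mem_compositions => /andP[c1 /eqP cm].
  rewrite /F /= last_scanl_addn cm add1n cR_tailE // map_nth_pairmap.
  by rewrite map_cR_arg //= ?drop0 ?cm // -cm reshape_take.
- exact: iota_uniq.
- apply: allpairs_uniq_dep; first exact: iota_uniq.
    by move=> m _; exact: compositions_uniq.
  move=> i1 i2 /allpairsPdep[m [c [_ cm ->]]].
  move=> /allpairsPdep[m' [c' [_ cm' ->]]] /= [].
  move/(can_inj (@scanlK _ _ (fun y z => z - y)%N addn addKn _)) => cc.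
  move: cm cm'; rewrite !mem_compositions -cc.
  by move=> /andP[_ /eqP<-] /andP[_ /eqP<-].
move=> i; apply/allpairsPdep/and3P => [[m [c [mn cm ->]]]|[]].
  move: mn cm; rewrite mem_iota mem_compositions add0n => /= mn.
  move=> /andP[c1 /eqP cm].
  rewrite mem_index_iota /P /= path_scanl_addn c1 size_scanl; split=> //.
    by rewrite !ltnS (leq_trans (size_le_sumn c c1)) ?cm.
  have := path_ltn_le_last 1%N (scanl addn 1%N c).
  rewrite path_scanl_addn last_scanl_addn cm => /(_ c1) /allP le_m.
  apply/allP => p /(@mem_behead _ (1%N :: _)) pc; rewrite /= ltnS.
  exact: leq_trans (le_m p pc) _.
case: i => [|x p]; rewrite /P //= => _ pN /andP[/eqP x1 p_path]; subst x.
pose c := pairmap (fun y z => z - y)%N 1%N p.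
have cE : scanl addn 1%N c = p by exact: scanl_addn_diff.
exists (sumn c), c; rewrite cE; split=> //.
  have := allP (pN : all _ (1%N :: p)) _ (mem_last 1%N p).
  by rewrite -cE last_scanl_addn -[_ :: iota _ _]/(iota 0 n.+1) mem_iota.
by rewrite mem_compositions eqxx andbT -(path_scanl_addn 1) cE.
Qed.
End Series.

(** * The formula for cR *)

Theorem theorem3p3 (K : fieldType) (B : nuAlgType K) (beta gamma : mulseries B) :
  cR beta gamma =
  series_comp (beta * series_mulinv (1 + series_id B * beta))
    (series_compinv (series_id B + series_id B * gamma * series_id B)).
Proof.
have Ib0 : ev (series_id B * beta) [::] = 0 by rewrite ev_id_mul.
have [uv vu] := xgetPex 0 (mulinv_exists _ Ib0).
have [_ _ ex xe] := xgetPex 0 (compinv_exists _ (cR_eta_nil gamma)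
                                 (cR_eta_singleton gamma)).
rewrite -/(series_mulinv _) in uv vu; rewrite -/(series_compinv _) in ex xe.
rewrite -/(cR_eta gamma).
set v := series_mulinv _ in uv vu *; set xi := series_compinv _ in ex xe *.
have cRP : is_cR beta gamma (cR beta gamma).
  apply: xgetPex; exists (series_comp (beta * v) xi) => s.
  by rewrite cR_sumE comp_seriesA xe comp_series_id -mulrA vu mulr1.
have RE : series_comp (cR beta gamma) (cR_eta gamma)
            * (1 + series_id B * beta) = beta.
  by apply: ev_inj => s; rewrite -cR_sumE cRP.
by rewrite -[in RHS]RE -mulrA uv mulr1 comp_seriesA ex comp_series_id.
Qed.
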